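(* There exist absolute constants $c_1,c_2>0$ such that the following holds. Let $d,k\ge1$, let $n\ge2$, let $P\subseteq B(0,1)\subset\mathbb{R}^d$ be a finite set with $|P|\le n$, and let $\Theta\ge1$. If a function $\widetilde{\mathrm{val}}$ assigning a non-negative number to every net point satisfies the $\Theta$-threshold condition (with respect to $P$), then the set $\mathcal{C}=\{c_1,\dots,c_k\}$ output by $\textsc{RecursiveGreedy}(\widetilde{\mathrm{val}},k)$ satisfies $$\mathrm{cost}(P,\mathcal{C})\le c_1\cdot\mathrm{OPT}_k(P)+c_2\cdot k\,\Theta,$$ i.e. it is an $(O(1),O(k\Theta))$-approximate solution to $k$-means on $P$.
   Context: $\mathrm{cost}(P,\mathcal{S})=\sum_{p\in P}\min_{s\in\mathcal{S}}\|p-s\|_2^2$ and $\mathrm{OPT}_k(P)$ is its minimum over all sets $\mathcal{S}\subset\mathbb{R}^d$ of $k$ points. Let $L=\lceil\log_2 n\rceil$. Net decomposition: for each level $i\in\{1,\dots,L\}$, $Z_i$ is a $2^{-(i+1)}$-net of the closed unit ball $B(0,1)$ (packing: distinct points of $Z_i$ are at distance $>2^{-(i+1)}$; covering: every point of $B(0,1)$ is within distance $2^{-(i+1)}$ of $Z_i$); the $Z_i$ are pairwise disjoint and elements of $Z_i$ are net points of level $\mathrm{level}(z)=i$. For $z\in Z_i$ and $l>0$, the $l$-neighborhood is $N^l(z)=B(z,l\,2^{-i})$. The children of $z\in Z_i$ are the net points of $Z_{i+1}$ lying in $N^4(z)$. The value of $z\in Z_i$ is $\mathrm{val}(z)=2^{-2i}|N^1(z)\cap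 P|$. A function $\widetilde{\mathrm{val}}$ satisfies the $\Theta$-threshold condition if for every net point $z$: if $\widetilde{\mathrm{val}}(z)\ge\Theta$ then $\widetilde{\mathrm{val}}(z)\in[\mathrm{val}(z)/2,\,2\,\mathrm{val}(z)]$, and if $\widetilde{\mathrm{val}}(z)<\Theta$ then $\mathrm{val}(z)\le2\Theta$. Algorithm $\textsc{RecursiveGreedy}(\widetilde{\mathrm{val}},k)$: initially every net point in $\bigcup_iZ_i$ is available. For $j=1,\dots,k$: let $z_j^1$ be an available net point with largest $\widetilde{\mathrm{val}}$; set $l=1$; while $\mathrm{level}(z_j^l)<L$, let $z_j^{l+1}$ be a child of $z_j^l$ with largest $\widetilde{\mathrm{val}}$ and increase $l$ by one; set $c_j=z_j^l$; then remove from the set of available net points every available net point $z$ with $c_j\in N^{89}(z)$. Output $\mathcal{C}=(c_1,\dots,c_k)$. *)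

(* Defs.v *)
From mathcomp Require Import all_boot all_order all_algebra finmap.
From mathcomp Require Import all_classical all_reals.

Set Implicit Arguments.
Unset Strict Implicit.
Unset Printing Implicit Defensive.

Import Order.TTheory GRing.Theory Num.Theory.

Local Open Scope classical_set_scope.
Local Open Scope ring_scope.

(* The Euclidean norm; the norm that MathComp-Analysis puts on matrices is the
   sup norm. *)
Definition l2norm (R : realType) (d : nat) (x : 'rV[R]_d) : R :=
  Num.sqrt (\sum_(i < d) x 0 i ^+ 2).

Definition cball (R : realType) (d : nat) (x : 'rV[R]_d) (r : R) :
    pred 'rV[R]_d :=
  fun y => l2norm (y - x) <= r.

(* The infimum is a minimum whenever S is finite and nonempty. *)
Definition cost (R : realType) (d : nat) (P : {fset 'rV[R]_d})
    (S : set 'rV[R]_d) : R :=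
  \sum_(p <- P) inf [set l2norm (p - s) ^+ 2 | s in S].

Definition OPT (R : realType) (d k : nat) (P : {fset 'rV[R]_d}) : R :=
  inf [set cost P [set` S] | S in [set S : {fset 'rV[R]_d} | #|` S| = k]].

Definition is_net (R : realType) (d : nat) (e : R) (A N : set 'rV[R]_d) :
    Prop :=
  [/\ N `<=` A,
      forall x y, N x -> N y -> x <> y -> e < l2norm (x - y)
    & forall x, A x -> exists2 z, N z & l2norm (x - z) <= e].

(* Z i is the set of net points of level i; only the levels 1, ..., L count. *)
Definition net_decomposition (R : realType) (d L : nat)
    (Z : nat -> set 'rV[R]_d) : Prop :=
  (forall i, (1 <= i <= L)%N -> is_net (2 ^- i.+1) [set` cball 0 1] (Z i)) /\
  trivIset [set i | (1 <= i <= L)%N] Z.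

(* A net point is handled together with its level, as a pair (i, z) with z in
   Z i. *)
Definition netpoints (R : realType) (d L : nat) (Z : nat -> set 'rV[R]_d) :
    set (nat * 'rV[R]_d) :=
  [set iz | (1 <= iz.1 <= L)%N /\ Z iz.1 iz.2].

(* N^l(z), for z of level i *)
Definition neighborhood (R : realType) (d : nat) (l : R) (i : nat)
    (z : 'rV[R]_d) : pred 'rV[R]_d :=
  cball z (l * 2 ^- i).

Definition children (R : realType) (d : nat) (Z : nat -> set 'rV[R]_d)
    (i : nat) (z : 'rV[R]_d) : set 'rV[R]_d :=
  Z i.+1 `&` [set` neighborhood 4 i z].

Definition val_net (R : realType) (d : nat) (P : {fset 'rV[R]_d}) (i : nat)
    (z : 'rV[R]_d) : R :=
  2 ^- (2 * i) * #|` [fset p in P | neighborhood 1 i z p]%fset |%:R.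

Definition threshold_condition (R : realType) (d L : nat)
    (Z : nat -> set 'rV[R]_d) (P : {fset 'rV[R]_d}) (Theta : R)
    (v : 'rV[R]_d -> R) : Prop :=
  forall i z, netpoints L Z (i, z) ->
    (Theta <= v z -> val_net P i z / 2 <= v z <= 2 * val_net P i z) /\
    (v z < Theta -> val_net P i z <= 2 * Theta).

Definition is_largest (R : realType) (T : Type) (f : T -> R) (A : set T)
    (z : T) : Prop :=
  A z /\ forall z', A z' -> f z' <= f z.

(* descent Z L v i z c : the while loop, started at the net point z of level i,
   can end at c.  Ties between children may be broken arbitrarily. *)
Inductive descent (R : realType) (d : nat) (Z : nat -> set 'rV[R]_d) (L : nat)
    (v : 'rV[R]_d -> R) : nat -> 'rV[R]_d -> 'rV[R]_d -> Prop :=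
| descent_stop z : descent Z L v L z z
| descent_step i z z' c :
    (i < L)%N -> is_largest v (children Z i z) z' ->
    descent Z L v i.+1 z' c -> descent Z L v i z c.

(* greedy_rounds Z L v k A C : k rounds started with the set A of available net
   points can produce the centers C.  The procedure stops early when no net
   point is available any more. *)
Inductive greedy_rounds (R : realType) (d : nat) (Z : nat -> set 'rV[R]_d)
    (L : nat) (v : 'rV[R]_d -> R) :
    nat -> set (nat * 'rV[R]_d) -> seq 'rV[R]_d -> Prop :=
| greedy_done A : greedy_rounds Z L v 0 A [::]
| greedy_exhausted k A : A = set0 -> greedy_rounds Z L v k.+1 A [::]
| greedy_round k A i z c C :
    is_largest (fun iz => v iz.2) A (i, z) ->
    descent Z L v i z c ->
    greedy_rounds Z L v k
      (A `\` [set iz | neighborhood 89 iz.1 iz.2 c]) C ->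
    greedy_rounds Z L v k.+1 A (c :: C).

Definition recursive_greedy (R : realType) (d : nat) (Z : nat -> set 'rV[R]_d)
    (L : nat) (v : 'rV[R]_d -> R) (k : nat) (C : seq 'rV[R]_d) : Prop :=
  greedy_rounds Z L v k (netpoints L Z) C.

(* Main.v *)
(* Fix k reference centers S, moved into the unit ball.  Each s in S is either
   within O(2^-L) of C, or has a net point y(s) near s that no round
   removed, at a level comparable with the distance from s to C.  Points far
   from s relative to this level already pay enough for s, so only the values
   val(y(s)) have to be bounded.
   Small values contribute O(k Theta).  For the others, each of the k chains is
   charged through its first ball that contains no s in S in its double: the
   optimum pays the value of this ball.  If the chain left the neighborhood of s
   there, greediness makes this value dominate that of every net point that
   stayed available near s, both y(s) and the start of any later chain that also
   follows s.  Hence the last chain following s pays for s, and every other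
   chain pays for an arbitrary reference center.  Paying balls that share a point
   have rapidly increasing levels, so that the total is a geometric series. *)
Require Import Defs.
From mathcomp Require Import all_boot all_order all_algebra finmap.
From mathcomp Require Import all_classical all_reals.
From mathcomp Require Import ring lra.

Set Implicit Arguments.
Unset Strict Implicit.
Unset Printing Implicit Defensive.

Import Order.TTheory GRing.Theory Num.Theory.

Local Open Scope classical_set_scope.
Local Open Scope ring_scope.

(** * Euclidean norm and triangle inequality *)

Section EuclideanNorm.
Variables (R : realType) (d : nat).
Implicit Types x y z : 'rV[R]_d.

Lemma l2norm_ge0 x : 0 <= l2norm x.
Proof. exact: sqrtr_ge0. Qed.

Lemma l2norm0 : l2norm (0 : 'rV[R]_d) = 0.
Proof.
by rewrite /l2norm big1 ?sqrtr0 // => i _; rewrite mxE expr0n.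
Qed.

Lemma l2norm_distC x y : l2norm (x - y) = l2norm (y - x).
Proof.
by congr Num.sqrt; apply: eq_bigr => i _; rewrite !mxE -sqrrN opprB.
Qed.

(** Lagrange's identity: twice the defect is the sum over [i], [j] of the squares of
    [x 0 i * y 0 j - x 0 j * y 0 i]. *)
Lemma sum_mul_sqr_le x y :
  (\sum_i x 0 i * y 0 i) ^+ 2 <= (\sum_i x 0 i ^+ 2) * (\sum_i y 0 i ^+ 2).
Proof.
set a := \sum_i x 0 i ^+ 2; set b := \sum_i y 0 i ^+ 2.
set e := \sum_i x 0 i * y 0 i.
suff : 0 <= a * b + b * a - 2 * (e * e) by rewrite expr2; lra.
rewrite /a /b /e !big_distrlr /= mulr_sumr -big_split /= -sumrB.
apply: sumr_ge0 => i _; rewrite mulr_sumr -big_split /= -sumrB.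
apply: sumr_ge0 => j _.
have := sqr_ge0 (x 0 i * y 0 j - x 0 j * y 0 i).
by congr (_ <= _); ring.
Qed.

Lemma ler_l2normD x y : l2norm (x + y) <= l2norm x + l2norm y.
Proof.
have sge0 z : 0 <= \sum_i z 0 i ^+ 2 by apply: sumr_ge0 => i _; apply: sqr_ge0.
rewrite -(ler_pXn2r (n := 2)) ?nnegrE ?addr_ge0 ?l2norm_ge0 //.
rewrite sqrrD /l2norm !sqr_sqrtr //.
have -> : \sum_i (x + y) 0 i ^+ 2 =
    \sum_i x 0 i ^+ 2 + 2 * (\sum_i x 0 i * y 0 i) + \sum_i y 0 i ^+ 2.
  rewrite mulr_sumr -!big_split /=; apply: eq_bigr => i _; rewrite mxE; ring.
suff : \sum_i x 0 i * y 0 i <=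
    Num.sqrt (\sum_i x 0 i ^+ 2) * Num.sqrt (\sum_i y 0 i ^+ 2) by lra.
rewrite -sqrtrM //; apply: le_trans (ler_norm _) _.
by rewrite -sqrtr_sqr ler_wsqrtr // sum_mul_sqr_le.
Qed.

Lemma l2norm_distD z x y : l2norm (x - y) <= l2norm (x - z) + l2norm (z - y).
Proof. by apply: le_trans (ler_l2normD _ _); rewrite addrA subrK. Qed.

End EuclideanNorm.

(** * Dyadic radii *)

Section Radii.
Variable R : realType.

Lemma pow2N_gt0 i : 0 < 2 ^- i :> R.
Proof. by rewrite invr_gt0 exprn_gt0. Qed.

Lemma pow2NS i : 2 ^- i.+1 = 2 ^- i / 2 :> R.
Proof. by rewrite exprS invfM mulrC. Qed.

Lemma pow2N_double i : 2 ^- (2 * i) = (2 ^- i) ^+ 2 :> R.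
Proof. by rewrite mulnC exprM exprVn. Qed.

Lemma ler_pow2N i j : (i <= j)%N -> 2 ^- j <= 2 ^- i :> R.
Proof.
by move=> le_ij; rewrite lef_pV2 ?posrE ?exprn_gt0 // ler_weXn2l // ler1n.
Qed.

End Radii.

(** * Squared distance to a set of centers *)

Section SquaredDistance.
Variables (R : realType) (d : nat).
Implicit Types (p s : 'rV[R]_d) (S : set 'rV[R]_d).

Lemma le_inf_sqdist p S (x : R) : S !=set0 ->
  (forall s, S s -> x <= l2norm (p - s) ^+ 2) ->
  x <= inf [set l2norm (p - s) ^+ 2 | s in S].
Proof.
move=> [s0 Ss0] hx; apply: lb_le_inf; first by exists (l2norm (p - s0) ^+ 2), s0.
by move=> _ [s Ss <-]; apply: hx.
Qed.

Lemma inf_sqdist_le p S s : S s ->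
  inf [set l2norm (p - s) ^+ 2 | s in S] <= l2norm (p - s) ^+ 2.
Proof.
move=> Ss; apply: ge_inf; last by exists s.
by exists 0 => _ [s' _ <-]; apply: sqr_ge0.
Qed.

Lemma cost_ge0 (P : {fset 'rV[R]_d}) S : 0 <= cost P S.
Proof.
apply: sumr_ge0 => p _; have [->|/set0P S0] := eqVneq S set0.
  by rewrite image_set0 inf0.
by apply: le_inf_sqdist => // s _; apply: sqr_ge0.
Qed.

End SquaredDistance.

Lemma seq_argmax (R : realType) (T : eqType) (F : T -> R) (r : seq T) x0 :
  x0 \in r -> exists2 x, x \in r & forall y, y \in r -> F y <= F x.
Proof.
elim: r x0 => // a r IH x0 _; case: r IH => [|b r] IH.
  by exists a => [|y]; rewrite inE // => /eqP->.
have [x xr xmax] := IH b (mem_head _ _).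
have [ax|/ltW xa] := lerP (F a) (F x).
  by exists x => [|y]; rewrite inE ?xr ?orbT // => /predU1P[->|/xmax].
exists a => [|y]; rewrite inE ?eqxx // => /predU1P[->//|/xmax yx].
exact: le_trans xa.
Qed.

(** * Net points and their values *)

Section Charging.
Variables (R : realType) (d L : nat) (Z : nat -> set 'rV[R]_d).
Variables (P : {fset 'rV[R]_d}) (Theta : R) (v : 'rV[R]_d -> R).
Hypothesis netZ : net_decomposition L Z.
Hypothesis Theta_gt0 : 0 < Theta.
Hypothesis thr : threshold_condition L Z P Theta v.
Notation V := 'rV[R]_d.
Implicit Types (S C : {fset V}) (z c p s : V) (A : set (nat * V)).

Lemma netpoints_ball i z : netpoints L Z (i, z) -> l2norm z <= 1.
Proof.
case=> /= hi hz; have [/(_ i hi) [sub _ _] _] := netZ.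
by have := sub _ hz; rewrite /= unfold_in /cball subr0.
Qed.

Lemma net_cover i z : (1 <= i <= L)%N -> l2norm z <= 1 ->
  exists2 w, netpoints L Z (i, w) & l2norm (z - w) <= 2 ^- i / 2.
Proof.
move=> hi hz; have [/(_ i hi) [_ _ cov] _] := netZ.
have [|w Zw hw] := cov z; first by rewrite /= unfold_in /cball subr0.
by exists w => //; rewrite -pow2NS.
Qed.

(** The share of [p] in the value of [z], so that values can be compared with squared distances
    point by point. *)
Definition ball_weight (i : nat) z p : R :=
  if l2norm (p - z) <= 2 ^- i then (2 ^- i) ^+ 2 else 0.

Lemma ball_weight_ge0 i z p : 0 <= ball_weight i z p.
Proof. by rewrite /ball_weight; case: ifP => // _; apply: sqr_ge0. Qed.

Lemma val_netE i z : val_net P i z = \sum_(p <- P) ball_weight i z p.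
Proof.
rewrite /val_net pow2N_double.
have -> : #|` [fset p in P | neighborhood 1 i z p]%fset | =
    count (fun p => l2norm (p - z) <= 2 ^- i) P.
  rewrite -size_filter; apply: perm_size; apply: uniq_perm.
  - exact: fset_uniq.
  - by rewrite filter_uniq.
  by move=> p; rewrite mem_filter !inE /= /neighborhood /cball mul1r andbC.
rewrite /ball_weight -big_mkcond /= big_const_seq iter_addr addr0.
by rewrite mulr_natr.
Qed.

(* As [c] misses [y] by a factor 89, the level of [y] is well below [i], so a
   child of [z] near [y] contains the whole ball of [y] and has a larger value. *)
Lemma largest_child_val i z z' c s l y :
  netpoints L Z (i, z) -> (i < L)%N -> is_largest v (children Z i z) z' ->
  l2norm (s - z) <= 2 * 2 ^- i -> l2norm (c - z) <= 8 * 2 ^- i ->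
  netpoints L Z (l, y) -> Theta <= v y ->
  89 * 2 ^- l < l2norm (c - y) -> l2norm (y - s) <= 10 * 2 ^- l ->
  v y <= val_net P i.+1 z'.
Proof.
move=> nz ltiL [[Zz' _] z'max] sz cz ny Ty cy ys.
have t0 := pow2N_gt0 R l; have u0 := pow2N_gt0 R i.
have rad : 79 * 2 ^- l <= 10 * 2 ^- i :> R.
  have := l2norm_distD s c y; have := l2norm_distD z c s.
  rewrite (l2norm_distC z s) (l2norm_distC s y); lra.
have iL : (1 <= i.+1 <= L)%N by [].
have [w nw yw] := net_cover iL (netpoints_ball ny).
rewrite pow2NS in yw.
have vw : v w <= v z'.
  apply: z'max; split; first by case: nw.
  rewrite /= unfold_in /cball.
  have := l2norm_distD y w z; have := l2norm_distD s y z.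
  rewrite (l2norm_distC w y); lra.
(* The factor 8 absorbs the three factors 2 lost between [v] and the true values of [y], [w] and
   [z']. *)
have valyw : 8 * val_net P l y <= val_net P i.+1 w.
  rewrite !val_netE mulr_sumr; apply: ler_sum => p _.
  have [py|py] := boolP (l2norm (p - y) <= 2 ^- l); last first.
    by rewrite /ball_weight (negbTE py) mulr0 ball_weight_ge0.
  have pw : l2norm (p - w) <= 2 ^- i.+1.
    rewrite pow2NS; have := l2norm_distD y p w; lra.
  rewrite /ball_weight py pw pow2NS; nra.
have [thr1 _] := thr ny; have /andP[_ vy] := thr1 Ty.
have [thrw1 thrw2] := thr nw.
have Tw : Theta <= v w.
  by rewrite leNgt; apply/negP => /thrw2; have := Theta_gt0; lra.
have /andP[wv _] := thrw1 Tw.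
have nz' : netpoints L Z (i.+1, z') by split.
have [thrz _] := thr nz'.
have Tz : Theta <= v z' by lra.
have /andP[_ vz'] := thrz Tz; lra.
Qed.

(** * Descending chains and their payments *)

(** The step from level [j] has length at most [4 * 2 ^- j]; the geometric series stays below
    [8 * 2 ^- i]. *)
Lemma descent_net i z c : descent Z L v i z c -> netpoints L Z (i, z) ->
  Z L c /\ l2norm (c - z) <= 8 * 2 ^- i.
Proof.
elim=> {i z c} [z|i z z' c iL [[Zz' zz'] _] _ IH] nz.
  split; first by case: nz.
  by rewrite subrr l2norm0 mulr_ge0 // ltW // pow2N_gt0.
have [|Zc cz'] := IH; first by split.
split=> //; move: zz' cz'; rewrite /= unfold_in /cball pow2NS.
have := l2norm_distD z' c z; lra.
Qed.

(** Because of the doubled radius, each point within [2 ^- i] of [z] is farther than [2 ^- i] from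
    [S], so its cost exceeds its [ball_weight]. *)
Definition far_from S (i : nat) z :=
  forall s, s \in S -> 2 * 2 ^- i < l2norm (z - s).

Lemma near_or_far S i z :
  (exists2 s, s \in S & l2norm (s - z) <= 2 * 2 ^- i) \/ far_from S i z.
Proof.
have [?|nears] := pselect (exists2 s, s \in S & l2norm (s - z) <= 2 * 2 ^- i).
  by left.
right=> s sS; rewrite ltNge l2norm_distC; apply/negP => sz.
by apply: nears; exists s.
Qed.

(** Follow the chain while its double ball contains a reference center, which may change from level
    to level. The bound [8 * (2 ^- i - 2 ^- e)] sums the steps [4 * 2 ^- j] for [i <= j < e]. *)
Lemma descent_capture S i z c s : descent Z L v i z c ->
  netpoints L Z (i, z) -> s \in S -> l2norm (s - z) <= 2 * 2 ^- i ->
  exists e w s',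
    [/\ (i <= e)%N, netpoints L Z (e, w), l2norm (w - z) <= 8 * (2 ^- i - 2 ^- e)
      & l2norm (c - w) <= 8 * 2 ^- e] /\
    [/\ s' \in S, l2norm (s' - w) <= 2 * 2 ^- e &
      e = L \/ exists w', [/\ (e < L)%N, is_largest v (children Z e w) w',
                             descent Z L v e.+1 w' c & far_from S e.+1 w']].
Proof.
move=> desc; elim: desc s => {i z c} [z|i z z' c iL z'max desc IH] s nz sS sz.
  exists L, z, s; split; last by split=> //; left.
  by rewrite !subrr mulr0 l2norm0 mulr_ge0 // ltW // pow2N_gt0.
have nz' : netpoints L Z (i.+1, z') by split=> //; case: z'max => -[].
have zz' : l2norm (z' - z) <= 4 * 2 ^- i by case: z'max => -[].
have [[s' s'S s'z']|farz'] := near_or_far S i.+1 z'.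
  have [e [w [s'' [[ie nw wz' cw] rest]]]] := IH s' nz' s'S s'z'.
  exists e, w, s''; split=> //; split=> //; first exact: ltnW.
  by rewrite pow2NS in wz'; have := l2norm_distD z' w z; lra.
exists i, z, s; split; last by split=> //; right; exists z'.
have [_ cz] := descent_net (descent_step iL z'max desc) nz.
by rewrite !subrr mulr0 l2norm0.
Qed.

(* What the chain descending from [(i, z)] to [c] forces [S] to pay: it pays on
   the first ball of the chain that is far from [S], and nothing if the chain
   stays close to [S] down to level [L]. *)
Definition payment S i z c (f : V -> R) :=
  f = (fun=> 0) \/ exists e w, f = ball_weight e w /\
    [/\ (i <= e)%N, l2norm (w - z) <= 8 * (2 ^- i - 2 ^- e),
        l2norm (c - w) <= 8 * 2 ^- e & far_from S e w].

Lemma threshold_val_ge i z : netpoints L Z (i, z) -> Theta <= v z ->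
  v z <= 2 * val_net P i z.
Proof. by move=> nz Tz; have [/(_ Tz)/andP[]] := thr nz. Qed.

(** If the first ball is already far from [S], it pays for itself. Otherwise [s] is the reference
    center near the last captured ball, and the next ball pays by [largest_child_val]. *)
Lemma chain_payment S i z c : netpoints L Z (i, z) -> Theta <= v z ->
  descent Z L v i z c ->
  exists f, payment S i z c f /\
    (v z <= 2 * \sum_(p <- P) f p \/
     exists s, [/\ s \in S, l2norm (z - s) <= 10 * 2 ^- i &
       forall l y, netpoints L Z (l, y) -> Theta <= v y ->
         89 * 2 ^- l < l2norm (c - y) -> l2norm (y - s) <= 10 * 2 ^- l ->
         v y <= \sum_(p <- P) f p]).
Proof.
move=> nz Tz desc; have [_ cz] := descent_net desc nz.
have [[s sS sz]|farz] := near_or_far S i z; last first.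
  exists (ball_weight i z); rewrite -val_netE; split.
    by right; exists i, z; rewrite !subrr mulr0 l2norm0.
  by left; apply: threshold_val_ge.
have [e [w [s' [[ie nw wz cw] [s'S s'w stop]]]]] :=
  descent_capture desc nz sS sz.
have zs' : l2norm (z - s') <= 10 * 2 ^- i.
  have := l2norm_distD w s' z; rewrite (l2norm_distC s' z).
  have := pow2N_gt0 R e; have := ler_pow2N R ie; lra.
case: stop => [eL|[w' [ltL w'max desc' farw']]].
  (* Here [c] is within [10 * 2 ^- L] of [s'], hence within [20 * 2 ^- l] of [y]: the claim is
     vacuous. *)
  exists (fun=> 0); split; first by left.
  right; exists s'; split=> // l y [/= /andP[_ lL] _] _ cy ys'.
  have := ler_pow2N R lL; rewrite -eL.
  have := l2norm_distD s' c y; have := l2norm_distD w c s'.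
  rewrite (l2norm_distC w s') (l2norm_distC s' y).
  have := pow2N_gt0 R e; lra.
have nw' : netpoints L Z (e.+1, w') by split=> //; case: w'max => -[].
have ww' : l2norm (w' - w) <= 4 * 2 ^- e by case: w'max => -[].
have [_ cw'] := descent_net desc' nw'.
exists (ball_weight e.+1 w'); rewrite -val_netE; split.
  right; exists e.+1, w'; split=> //; split=> //; first exact: leqW.
  by rewrite pow2NS; have := l2norm_distD w w' z; lra.
right; exists s'; split=> // l y ny Ty cy ys'.
exact: (largest_child_val nw ltL w'max s'w cw ny Ty cy ys').
Qed.

(** * Removals and charging over the rounds *)

Definition removed c : set (nat * V) :=
  [set iz | neighborhood 89 iz.1 iz.2 c].

(* The second clause makes the payments received by a point [p] decrease
   geometrically from round to round: after a chain that ends near [p], the net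
   points near [p] that are still available have a much larger level. *)
Definition admissible S A (W : V -> R) := forall p,
  (forall s, s \in S -> W p <= 2 * l2norm (p - s) ^+ 2) /\
  (W p = 0 \/ exists l a, [/\ A (l, a), l2norm (p - a) <= 9 * 2 ^- l
                            & W p <= 2 * (2 ^- l) ^+ 2]).

(** [W] holds the payments of later rounds, whose starts survived the removal around [c]. Where the
    current chain pays [(2 ^- e) ^+ 2], the gap between 89 and 9 gives [80 * 2 ^- l <= 9 * 2 ^- e],
    so [W] at most doubles this. *)
Lemma admissible_payment S A i z c W f : A (i, z) ->
  admissible S (A `\` removed c) W -> payment S i z c f ->
  admissible S A (fun p => f p + W p).
Proof.
move=> Az okW pay p; have [WS Wa] := okW p.
have keep : f p = 0 -> (forall s, s \in S ->
      f p + W p <= 2 * l2norm (p - s) ^+ 2) /\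
    (f p + W p = 0 \/ exists l a, [/\ A (l, a), l2norm (p - a) <= 9 * 2 ^- l
                            & f p + W p <= 2 * (2 ^- l) ^+ 2]).
  move=> ->; rewrite add0r; split=> //.
  by case: Wa => [->|[l [a [[Aa _] pa Wl]]]]; [left | right; exists l, a].
case: pay keep => [-> keep|[e [w [-> [ie wz cw farw]]]]]; first exact: keep.
rewrite /ball_weight; case: ifP => [pw _|_ keep]; last exact: keep.
have u0 := pow2N_gt0 R e.
have Wu : W p <= (2 ^- e) ^+ 2.
  case: Wa => [->|[l [a [[_ /negP ca] pa Wl]]]]; first exact: sqr_ge0.
  move: ca; rewrite /= /neighborhood /cball -ltNge => ca.
  have t0 := pow2N_gt0 R l.
  have tu : 80 * 2 ^- l <= 9 * 2 ^- e :> R.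
    have := l2norm_distD w c a; have := l2norm_distD p w a.
    rewrite (l2norm_distC w p); lra.
  by apply: le_trans Wl _; nra.
split=> [s sS|].
  have ups : 2 ^- e <= l2norm (p - s).
    have := farw s sS; have := l2norm_distD p w s.
    rewrite (l2norm_distC w p); lra.
  nra.
right; exists i, z; split=> //.
  have := l2norm_distD w p z; have := ler_pow2N R ie; lra.
have := ler_pow2N R ie; nra.
Qed.

(** Induction from the last round backwards; [S1] collects the reference centers followed so far. A
    chain following a new [s] joins it to [S1] and covers [v (y s).2] if [s \in m]; every other
    chain covers [T]. *)
Lemma rounds_charge S (m : {fset V}) (y : V -> nat * V) (T : R)
    (ymax : nat * V) k A (C : seq V) :
  greedy_rounds Z L v k A C -> A `<=` netpoints L Z ->
  (forall s, s \in m -> [/\ netpoints L Z (y s), Theta <= v (y s).2,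
     l2norm ((y s).2 - s) <= 10 * 2 ^- (y s).1
     & forall c, c \in C -> ~ removed c (y s)]) ->
  A ymax -> Theta <= T -> T <= v ymax.2 ->
  (forall c, c \in C -> ~ removed c ymax) ->
  exists (S1 : {fset V}) (W : V -> R), [/\ (S1 `<=` S)%fset,
    forall s, s \in S1 -> exists l a, [/\ A (l, a),
      l2norm (a - s) <= 10 * 2 ^- l & T <= v a],
    admissible S A W &
    \sum_(s <- S1 | s \in m) v (y s).2 + (k%:R - #|` S1|%:R) * T <=
      2 * \sum_(p <- P) W p].
Proof.
move=> rounds; elim: rounds => {k A C}
  [A|k A ->|k A i z c C [Az zmax] desc rounds IH] sub hm Aymax TT Tymax avail.
- exists fset0, (fun=> 0); split=> //.
    by move=> p; split=> [s _|]; [rewrite mulr_ge0 // sqr_ge0 | left].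
  by rewrite big_mkcond big_seq_fset0 cardfs0 subrr mul0r big1 // mulr0 addr0.
(* [ymax] is still available, so the rounds cannot be exhausted. *)
- by [].
have nz := sub _ Az.
have Tz : T <= v z by apply: le_trans Tymax (zmax _ Aymax).
have Thz : Theta <= v z by apply: le_trans TT Tz.
have [|s sm||//|//|d' d'C|S1 [W [S1S capt okW sumW]]] := IH.
- by move=> x [/sub].
- have [? ? ? h] := hm s sm; split=> // c' c'C.
  by apply: h; rewrite inE c'C orbT.
- by split=> //; apply: avail; rewrite inE eqxx.
- by apply: avail; rewrite inE d'C orbT.
have [f [payf okf]] := chain_payment S nz Thz desc.
have okfW := admissible_payment Az okW payf.
have f_ge0 : 0 <= \sum_(p <- P) f p.
  apply: sumr_ge0 => p _; case: payf => [->//|[e [w [-> _]]]].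
  exact: ball_weight_ge0.
have capt' s : s \in S1 -> exists l a, [/\ A (l, a),
    l2norm (a - s) <= 10 * 2 ^- l & T <= v a].
  by move/capt => [l [a [[Aa _] as_ Ta]]]; exists l, a.
have paid : T <= 2 * \sum_(p <- P) f p -> exists (S1 : {fset V}) (W : V -> R),
  [/\ (S1 `<=` S)%fset,
    forall s, s \in S1 -> exists l a, [/\ A (l, a),
      l2norm (a - s) <= 10 * 2 ^- l & T <= v a],
    admissible S A W &
    \sum_(s <- S1 | s \in m) v (y s).2 + (k.+1%:R - #|` S1|%:R) * T <=
      2 * \sum_(p <- P) W p].
  move=> Tf; exists S1, (fun p => f p + W p); split=> //.
  rewrite big_split /= -natr1; lra.
case: okf => [zf|[s [sS zs hs]]]; first by apply: paid; lra.
have [sS1|sS1] := boolP (s \in S1).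
  (* The later chain following [s] started at some [a] that survived the removal around [c], so the
     present chain pays at least [v a]. *)
  have [l [a [[Aa /negP ca] as_ Ta]]] := capt _ sS1.
  apply: paid; suff : v a <= \sum_(p <- P) f p by lra.
  apply: hs as_ => //; first exact: sub.
    exact: le_trans Ta.
  by move: ca; rewrite /= /neighborhood /cball -ltNge.
exists (s |` S1)%fset, (fun p => f p + W p); split=> //.
- by apply/fsubsetP => x /fset1UP[->//|]; apply/fsubsetP.
- move=> x /fset1UP[->|]; last exact: capt'.
  by exists i, z.
have -> : k.+1%:R - #|` (s |` S1)%fset|%:R = k%:R - #|` S1|%:R :> R.
  by rewrite cardfsU1 sS1 add1n -!natr1 opprD addrACA subrr addr0.
rewrite big_split /= big_mkcond big_fsetU1 //= -big_mkcond /=.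
have vs : (if s \in m then v (y s).2 else 0) <= 2 * \sum_(p <- P) f p.
  case: ifP => sm; last by rewrite mulr_ge0.
  have [nys Tys ys h] := hm s sm.
  suff : v (y s).2 <= \sum_(p <- P) f p by lra.
  apply: hs ys => //.
  have /negP := h c (mem_head _ _).
  by rewrite /= /neighborhood /cball -ltNge.
by rewrite mulrDr -addrA lerD.
Qed.

(** Take for [T] the largest value on [m]. Members of [S1] are paid individually; at most
    [k - #|S1|] others remain, covered by the payments [T]. *)
Lemma sum_val_le_cost (S m : {fset V}) (y : V -> nat * V) k (C : seq V) :
  recursive_greedy Z L v k C -> (#|` S| <= k)%N -> (m `<=` S)%fset ->
  (forall s, s \in m -> [/\ netpoints L Z (y s), Theta <= v (y s).2,
     l2norm ((y s).2 - s) <= 10 * 2 ^- (y s).1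
     & forall c, c \in C -> ~ removed c (y s)]) ->
  \sum_(s <- m) v (y s).2 <= 4 * cost P [set` S].
Proof.
move=> rounds Sk mS hm; have [->|/fset0Pn[s0 s0m]] := eqVneq m fset0.
  by rewrite big_seq_fset0 mulr_ge0 ?cost_ge0.
have [sx sxm smax] := seq_argmax (fun s => v (y s).2) s0m.
have [nx Tx _ hx] := hm sx sxm.
have [//|S1 [W [S1S _ okW sumW]]] :=
  rounds_charge S rounds _ hm nx Tx (lexx _) hx.
have W_le : \sum_(p <- P) W p <= 2 * cost P [set` S].
  rewrite /cost mulr_sumr; apply: ler_sum => p _.
  suff : W p / 2 <= inf [set l2norm (p - s) ^+ 2 | s in [set` S]] by lra.
  apply: le_inf_sqdist => [|s /= sS]; first by exists sx; apply: (fsubsetP mS).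
  have [/(_ s sS) ? _] := okW p; lra.
apply: (le_trans _ (_ : 2 * \sum_(p <- P) W p <= _)); last by lra.
apply: le_trans sumW.
have swap : [fset s in m | s \in S1]%fset = [fset s in S1 | s \in m]%fset.
  by apply/fsetP => s; rewrite !inE andbC.
rewrite (bigID (mem S1)) /= lerD //; first by rewrite [leLHS]big_fset_condE [leRHS]big_fset_condE swap.
rewrite big_fset_condE.
apply: le_trans (_ : \sum_(s <- [fset x in m | x \notin S1]%fset) v (y sx).2 <= _).
  rewrite big_seq [leRHS]big_seq; apply: ler_sum => s.
  by rewrite !inE /= => /andP[/smax].
rewrite big_const_seq count_predT iter_addr addr0 -[leLHS]mulr_natl.
have Tge0 : 0 <= v (y sx).2 by apply: le_trans Tx; apply: ltW.
apply: ler_wpM2r => //.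
rewrite lerBrDr -natrD ler_nat; apply: leq_trans Sk.
have -> : [fset x in m | x \notin S1]%fset = (m `\` S1)%fset.
  by apply/fsetP => s; rewrite !inE andbC.
have := fsubset_leq_card (fsetSD S1 mS).
have := fsubset_leq_card S1S; rewrite (cardfsDS S1S) => ? ?.
by rewrite addnC -leq_subRL.
Qed.

(** * Cost of the greedy centers *)

Lemma rounds_net k A (C : seq V) c : greedy_rounds Z L v k A C ->
  A `<=` netpoints L Z -> c \in C -> Z L c.
Proof.
elim=> {k A C} [//|//|k A i z c' C [Az _] desc _ IH] sub.
rewrite inE => /predU1P[->|]; last by apply: IH => x [/sub].
by have [] := descent_net desc (sub _ Az).
Qed.

Lemma rounds_nonempty k A (C : seq V) : greedy_rounds Z L v k A C ->
  (0 < k)%N -> A !=set0 -> exists c, c \in C.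
Proof.
case=> {k A C} [//|k A -> _ [//]|k A i z c C _ _ _ _ _].
by exists c; rewrite mem_head.
Qed.

(** Take the coarsest level at which a net point near [s] escapes all removals. One level above, the
    net point covering [s] was removed, so a center lies within [89 + 1/2] radii of that level. *)
Lemma near_center_or_spared (C : seq V) c0 s : (0 < L)%N ->
  c0 \in C -> (forall c, c \in C -> l2norm c <= 1) -> l2norm s <= 1 ->
  (exists2 c, c \in C & l2norm (s - c) <= 90 * 2 ^- L) \/
  exists ly, [/\ netpoints L Z ly, l2norm (s - ly.2) <= 2 ^- ly.1 / 2,
    forall c, c \in C -> ~ removed c ly
    & exists2 c, c \in C & l2norm (s - c) <= 180 * 2 ^- ly.1].
Proof.
move=> L0 c0C C1 s1.
pose spared i := `[< exists w, [/\ netpoints L Z (i, w),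
  l2norm (s - w) <= 2 ^- i / 2 & forall c, c \in C -> ~ removed c (i, w)] >].
have close i : (1 <= i <= L)%N -> ~~ spared i ->
    exists2 c, c \in C & l2norm (s - c) <= 90 * 2 ^- i.
  move=> iL /asboolPn nspared; have [w nw sw] := net_cover iL s1.
  have [c cC cw] : exists2 c, c \in C & removed c (i, w).
    apply: contrapT => h; apply: nspared; exists w; split=> // c cC cw.
    by apply: h; exists c.
  exists c => //; move: cw; rewrite /removed /= /neighborhood /cball.
  have := l2norm_distD w s c; rewrite (l2norm_distC w c).
  have := pow2N_gt0 R i; lra.
have [ex|nex] := pselect (exists i, spared i); last first.
  left; apply: close; first by rewrite L0 /=.
  by apply/negP => h; apply: nex; exists L.
right; have [i /asboolP[w [nw sw hw]] imin] := find_ex_minn ex.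
exists (i, w); split=> //=.
case: i nw imin {sw hw} => [[]//|[|j]] nw imin.
  (* At level 1 there is no coarser level, but both points lie in the unit ball. *)
  exists c0 => //; have := l2norm_distD 0 s c0; rewrite subr0 sub0r -[- c0]sub0r.
  by rewrite l2norm_distC subr0 expr1; have := C1 _ c0C; lra.
have [||c cC sc] := close j.+1; last by exists c => //; rewrite pow2NS; lra.
  by case: nw => /= /ltnW.
by apply/negP => /imin; rewrite ltnn.
Qed.

Lemma greedy_cost_le (S : {fset V}) k (C : seq V) : 1 <= Theta -> (0 < L)%N ->
  (#|` P| <= 2 ^ L)%N -> (0 < k)%N -> recursive_greedy Z L v k C ->
  S != fset0 -> (#|` S| <= k)%N -> (forall s, s \in S -> l2norm s <= 1) ->
  cost P [set` C] <= 700 ^+ 2 * cost P [set` S] + 400 ^+ 2 * k%:R * Theta.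
Proof.
move=> Theta1 L0 PL k0 rounds /fset0Pn[s0 s0S] Sk S1.
have C1 c : c \in C -> l2norm c <= 1.
  move=> cC; apply: (@netpoints_ball L); split; first by rewrite /= L0 leqnn.
  exact: rounds_net rounds _ cC.
have [c0 c0C] : exists c0, c0 \in C.
  have [w nw _] := @net_cover 1%N s0 L0 (S1 _ s0S).
  by apply: rounds_nonempty rounds k0 _; exists (1%N, w).
pose good (s : V) (ly : nat * V) := [/\ netpoints L Z ly, l2norm (s - ly.2) <= 2 ^- ly.1 / 2,
    forall c, c \in C -> ~ removed c ly
    & exists2 c, c \in C & l2norm (s - c) <= 180 * 2 ^- ly.1].
have [y hy] : {y : V -> nat * V &
    forall s, (exists ly, good s ly) -> good s (y s)}.
  apply: (@choice _ _ (fun s ly => (exists ly', good s ly') -> good s ly)) => s.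
  have [[ly gly]|nex] := pselect (exists ly, good s ly); first by exists ly.
  (* A default value; [y] is evaluated only on [E]. *)
  by exists (0%N, 0).
pose E := [fset s in S | `[< exists ly, good s ly >]]%fset.
have goodE s : s \in E -> good s (y s).
  by rewrite !inE => /andP[_ /asboolP/hy].
have point_le p : inf [set l2norm (p - c) ^+ 2 | c in [set` C]] <=
    400 ^+ 2 * inf [set l2norm (p - s) ^+ 2 | s in [set` S]] +
    200 ^+ 2 * (2 ^- L) ^+ 2 +
    200 ^+ 2 * \sum_(s <- E) ball_weight (y s).1 (y s).2 p.
  set X := inf _; set B := \sum_(s <- E) _.
  have B0 : 0 <= B by apply: sumr_ge0 => s _; apply: ball_weight_ge0.
  suff : (X - 200 ^+ 2 * (2 ^- L) ^+ 2 - 200 ^+ 2 * B) / 400 ^+ 2 <=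
    inf [set l2norm (p - s) ^+ 2 | s in [set` S]] by lra.
  apply: le_inf_sqdist => [|s /= sS]; first by exists s0.
  suff : X <= 400 ^+ 2 * l2norm (p - s) ^+ 2 + 200 ^+ 2 * (2 ^- L) ^+ 2 +
    200 ^+ 2 * B by lra.
  have a0 := l2norm_ge0 (p - s).
  have XC c : c \in C -> X <= l2norm (p - c) ^+ 2 by move=> cC; apply: inf_sqdist_le.
  have [[c cC sc]|ex] := near_center_or_spared L0 c0C C1 (S1 s sS).
    apply: le_trans (XC c cC) _.
    have := l2norm_distD s p c; have := l2norm_ge0 (p - c).
    have := pow2N_gt0 R L => u0 b0 tri.
    have : l2norm (p - c) ^+ 2 <= (l2norm (p - s) + 90 * 2 ^- L) ^+ 2.
      by rewrite ler_pXn2r ?nnegrE //; lra.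
    have := sqr_ge0 (l2norm (p - s) - 90 * 2 ^- L); nra.
  have sE : s \in E by rewrite !inE sS; apply/asboolP.
  have [_ sy _ [c cC sc]] := goodE s sE.
  apply: le_trans (XC c cC) _.
  have := l2norm_distD s p c; have := l2norm_ge0 (p - c).
  have := pow2N_gt0 R (y s).1 => u0 b0 tri.
  (* A far point has [181 * 2 ^- (y s).1]-type error bounded by [361 * l2norm (p - s)]; a near one
     lies in the ball of [y s], whose weight pays. *)
  have [far|near] := lerP (2 ^- (y s).1 / 2) (l2norm (p - s)).
    have : l2norm (p - c) ^+ 2 <= (361 * l2norm (p - s)) ^+ 2.
      by rewrite ler_pXn2r ?nnegrE //; lra.
    have := sqr_ge0 (2 ^- L : R); nra.
  have Bs : (2 ^- (y s).1) ^+ 2 <= B.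
    rewrite /B (big_fsetD1 s) //= /ball_weight ifT.
      by rewrite lerDl; apply: sumr_ge0 => ? _; apply: ball_weight_ge0.
    have := l2norm_distD s p (y s).2; lra.
  have : l2norm (p - c) ^+ 2 <= (181 * 2 ^- (y s).1) ^+ 2.
    by rewrite ler_pXn2r ?nnegrE //; lra.
  have := sqr_ge0 (2 ^- L : R); have := sqr_ge0 (l2norm (p - s)); nra.
pose m := [fset s in E | Theta <= v (y s).2]%fset.
have mE s : s \in m -> s \in E by rewrite !inE => /andP[].
have ES : (E `<=` S)%fset by apply/fsubsetP => s; rewrite !inE => /andP[].
have sum_m : \sum_(s <- m) v (y s).2 <= 4 * cost P [set` S].
  apply: sum_val_le_cost rounds Sk _ _.
    by apply/fsubsetP => s /mE; apply/fsubsetP.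
  move=> s sm; have [ny sy hs _] := goodE s (mE s sm).
  split=> //; first by move: sm; rewrite !inE => /andP[].
  by rewrite l2norm_distC; have := pow2N_gt0 R (y s).1; lra.
have sum_E : \sum_(p <- P) \sum_(s <- E) ball_weight (y s).1 (y s).2 p <=
    2 * k%:R * Theta + 8 * cost P [set` S].
  rewrite exchange_big /=.
  have -> : \sum_(s <- E) \sum_(p <- P) ball_weight (y s).1 (y s).2 p =
      \sum_(s <- E) val_net P (y s).1 (y s).2.
    by apply: eq_bigr => s _; rewrite val_netE.
  have : \sum_(s <- E) val_net P (y s).1 (y s).2 <=
      \sum_(s <- E) (2 * Theta + (if Theta <= v (y s).2 then 2 * v (y s).2 else 0)).
    rewrite big_seq [leRHS]big_seq; apply: ler_sum => s sE.
    have [ny _ _ _] := goodE s sE.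
    have [t1 t2] := @thr (y s).1 (y s).2 ltac:(by case: (y s) ny).
    case: ifPn => [Ty|]; last by rewrite -ltNge => /t2; lra.
    by have /andP[? _] := t1 Ty; have := Theta_gt0; lra.
  move/le_trans; apply; rewrite big_split /= -big_mkcond /=.
  rewrite [X in _ + X]big_fset_condE -/m -!mulr_sumr big_const_seq count_predT iter_addr addr0.
  have Ek : #|` E|%:R <= k%:R :> R.
    by rewrite ler_nat; apply: leq_trans (fsubset_leq_card ES) Sk.
  have : #|` E|%:R * Theta <= k%:R * Theta by rewrite ler_wpM2r // ltW.
  rewrite mulr_natl; lra.
have costC : cost P [set` C] <= 400 ^+ 2 * cost P [set` S] +
    200 ^+ 2 * (#|` P|%:R * (2 ^- L) ^+ 2) + 200 ^+ 2 *
    \sum_(p <- P) \sum_(s <- E) ball_weight (y s).1 (y s).2 p.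
  rewrite /cost !mulr_sumr.
  have -> : 200 ^+ 2 * (#|` P|%:R * (2 ^- L) ^+ 2) =
      \sum_(p <- P) (200 ^+ 2 * (2 ^- L) ^+ 2) :> R.
    rewrite big_const_seq count_predT iter_addr addr0 -mulr_natl; ring.
  by rewrite -!big_split /=; apply: ler_sum => p _.
have PL1 : #|` P|%:R * (2 ^- L) ^+ 2 <= 1 :> R.
  have : #|` P|%:R * 2 ^- L <= 1 :> R.
    by rewrite ler_pdivrMr ?exprn_gt0 // mul1r -natrX ler_nat.
  have := ler_pow2N R (leq0n L); rewrite expr0 invr1.
  have := pow2N_gt0 R L; nra.
(* This absorbs the level-[L] error. The constants fit: [400^2 + 8 * 200^2 <= 700^2] and
   [3 * 200^2 <= 400^2]. *)
have kT : 1 <= k%:R * Theta by rewrite mulr_ege1 // ler1n.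
have := cost_ge0 P [set` S]; lra.
Qed.

End Charging.

(** * Reference centers and the final bound *)

(** Ensures that the infimum in [OPT] ranges over a nonempty set. *)
Lemma exists_fset_card (R : realType) d k : (0 < d)%N ->
  exists S : {fset 'rV[R]_d}, #|` S| = k.
Proof.
case: d => // d _; exists [fset x in [seq const_mx i%:R | i <- iota 0 k]]%fset.
rewrite card_fseq undup_id ?size_map ?size_iota // map_inj_uniq ?iota_uniq //.
by move=> i j /matrixP/(_ 0 0); rewrite !mxE => /eqP; rewrite eqr_nat => /eqP.
Qed.

(* Moving every center to a nearest point of P at most doubles its distance to
   every point of P; this brings the centers into the unit ball. *)
Lemma recenter_cost_le (R : realType) d (P S : {fset 'rV[R]_d}) :
  P != fset0 -> S != fset0 ->
  exists S' : {fset 'rV[R]_d}, [/\ (S' `<=` P)%fset, S' != fset0,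
    (#|` S'| <= #|` S|)%N & cost P [set` S'] <= 4 * cost P [set` S]].
Proof.
move=> /fset0Pn[p0 p0P] /fset0Pn[s0 s0S].
have [f hf] : {f : 'rV[R]_d -> 'rV[R]_d & forall s,
    f s \in P /\ forall p, p \in P -> l2norm (s - f s) <= l2norm (s - p)}.
  apply: (@choice _ _ (fun s q => q \in P /\
    forall p, p \in P -> l2norm (s - q) <= l2norm (s - p))) => s.
  have [q qP qmin] := seq_argmax (fun p => - l2norm (s - p)) p0P.
  by exists q; split=> // p /qmin; rewrite lerN2.
exists (f @` S)%fset; split.
- by apply/fsubsetP => _ /imfsetP[s _ ->]; have [] := hf s.
- by apply/fset0Pn; exists (f s0); apply: in_imfset.
- exact: leq_imfset_card.
rewrite /cost mulr_sumr big_seq [leRHS]big_seq; apply: ler_sum => p pP.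
set X := inf _; suff : X / 4 <= inf [set l2norm (p - s) ^+ 2 | s in [set` S]].
  by lra.
apply: le_inf_sqdist => [|s /= sS]; first by exists s0.
have : X <= l2norm (p - f s) ^+ 2.
  by apply: inf_sqdist_le; apply: in_imfset.
have [_ /(_ p pP)] := hf s; have := l2norm_distD s p (f s).
rewrite (l2norm_distC s p) => ? ? ?.
have : l2norm (p - f s) ^+ 2 <= (2 * l2norm (p - s)) ^+ 2.
  by rewrite ler_pXn2r ?nnegrE ?mulr_ge0 ?l2norm_ge0 //; lra.
rewrite exprMn; lra.
Qed.

(* [up_log 2 n] is the ceiling of log_2 n. *)
Theorem mainTheorem4 (R : realType) :
  exists c1 c2 : R, 0 < c1 /\ 0 < c2 /\
  forall (d k n : nat) (Z : nat -> set 'rV[R]_d) (P : {fset 'rV[R]_d})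
    (Theta : R) (v : 'rV[R]_d -> R) (C : seq 'rV[R]_d),
    (1 <= d)%N -> (1 <= k)%N -> (2 <= n)%N ->
    net_decomposition (up_log 2 n) Z ->
    (forall p, p \in P -> cball 0 1 p) ->
    (#|` P| <= n)%N ->
    1 <= Theta ->
    (forall i z, netpoints (up_log 2 n) Z (i, z) -> 0 <= v z) ->
    threshold_condition (up_log 2 n) Z P Theta v ->
    recursive_greedy Z (up_log 2 n) v k C ->
    cost P [set` C] <= c1 * OPT k P + c2 * k%:R * Theta.
Proof.
(* [1400^2 = 4 * 700^2]: recentering at points of [P] costs the factor 4. *)
exists (1400 ^+ 2), (400 ^+ 2); split; first by lra.
split; first by lra.
move=> d k n Z P Theta v C d1 k1 n2 netZ Pball Pn Theta1 _ thr greedy.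
have Theta0 : 0 < Theta by lra.
suff : (cost P [set` C] - 400 ^+ 2 * k%:R * Theta) / 1400 ^+ 2 <= OPT k P by lra.
apply: lb_le_inf.
  by have [S Sk] := exists_fset_card R k d1; exists (cost P [set` S]), S.
move=> _ [S /= Sk <-].
suff : cost P [set` C] <= 1400 ^+ 2 * cost P [set` S] + 400 ^+ 2 * k%:R * Theta.
  by lra.
have [->|P0] := eqVneq P fset0.
  rewrite /cost !big_seq_fset0 mulr0 add0r !mulr_ge0 //; lra.
have S0 : S != fset0 by rewrite -cardfs_gt0 Sk.
have [S' [S'P S'0 S'S costS']] := recenter_cost_le P0 S0.
suff : cost P [set` C] <= 700 ^+ 2 * cost P [set` S'] + 400 ^+ 2 * k%:R * Theta.
  by lra.
apply: (greedy_cost_le netZ Theta0 thr Theta1 _ _ k1 greedy S'0).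
- by rewrite up_log_gt0 n2.
- exact: leq_trans Pn (up_logP _ _).
- by rewrite -Sk.
by move=> s /(fsubsetP S'P) /Pball; rewrite /cball subr0.
Qed.
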